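(* Let $\phi_1:(0,\infty)\to(0,\infty)$ be a measurable function, let $Z_1=S_2/S_1$, and consider the estimator $\delta_{\phi_1}=\phi_1(Z_1)S_1$ of $\sigma_1^2$. Put $$\phi_{11}^{E}(z_1)=\frac{1+z_1}{(m_1+m_2)\,E(\tau^{-1})}.$$ If $P\left(\phi_{11}^{E}(Z_1)<\phi_1(Z_1)\right)>0$, then the estimator $$\delta_{S1}^{E}=\min\left\{\phi_1(Z_1),\phi_{11}^{E}(Z_1)\right\}S_1$$ dominates $\delta_{\phi_1}$ with respect to the entropy loss $L_2$.
   Context: Model: $p,q,m_1,m_2$ are positive integers; $\tau$ is a positive random variable (mixing variable) with known distribution $\Pi$ on $(0,\infty)$, such that $E(\tau^{-1})$ is finite. Conditionally on $\tau$, the variables $\boldsymbol X_1,S_1,\boldsymbol X_2,S_2$ are independent with $\boldsymbol X_1\sim N_p(\boldsymbol\theta_1,\frac{\sigma_1^2}{\tau}I)$, $S_1\sim\frac{\sigma_1^2}{\tau}\chi^2_{m_1}$, $\boldsymbol X_2\sim N_q(\boldsymbol\theta_2,\frac{\sigma_2^2}{\tau}I)$, $S_2\sim\frac{\sigma_2^2}{\tau}\chi^2_{m_2}$ (the same $\tau$ for all four). The unknown parameters are $\boldsymbol\theta_1\in\mathbb R^p$, $\boldsymbol\theta_2\in\mathbb R^q$, $\sigma_1,\sigma_2>0$ with the order restriction $\sigma_1\le\sigma_2$. The entropy loss for estimating $\sigma^2$ by $\delta$ is $L_2(\delta,\sigma^2)=\delta/\sigma^2-\ln(\delta/\sigma^2)-1$;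 the risk of an estimator $\delta$ of $\sigma_1^2$ is $R(\delta)=E[L_2(\delta,\sigma_1^2)]$, a function of the parameters. The estimators to be improved are understood to have finite risk. An estimator $\delta'$ dominates $\delta$ if $R(\delta')\le R(\delta)$ for all admissible parameter values, with strict inequality for at least one. *)

(* Defs.v *)
From HB Require Import structures.
From mathcomp Require Import all_boot all_order all_algebra.
From mathcomp Require Import all_classical all_reals all_analysis.

Set Implicit Arguments.
Unset Strict Implicit.
Unset Printing Implicit Defensive.

Import Order.TTheory GRing.Theory Num.Theory.
Import numFieldNormedType.Exports.

Local Open Scope classical_set_scope.
Local Open Scope ring_scope.

Section distributions.
Context {R : realType}.

(* Lebesgue integral over R^n of a nonnegative function, as the iterated
   integral given by Tonelli's theorem. *)
Fixpoint integral_Rn (n : nat) : (n.-tuple R -> \bar R) -> \bar R :=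
  match n return (n.-tuple R -> \bar R) -> \bar R with
  | 0%N => fun f => f [tuple]
  | n'.+1 => fun f =>
      (\int[@lebesgue_measure R]_x integral_Rn (fun y => f [tuple of x :: y]))%E
  end.

(* Density of N_n(theta, v I); v is the variance of each coordinate. *)
Definition mvnormal_pdf (n : nat) (theta : n.-tuple R) (v : R)
    (x : n.-tuple R) : R :=
  (2 * pi * v) `^ (- (n%:R / 2)) *
  expR (- (\sum_(i < n) (tnth x i - tnth theta i) ^+ 2) / (2 * v)).

Definition mvnormal_prob (n : nat) (theta : n.-tuple R) (v : R)
    (A : set (n.-tuple R)) : \bar R :=
  integral_Rn (fun x => (mvnormal_pdf theta v x * \1_A x)%:E).

Definition Gamma (a : R) : R :=
  \int[@lebesgue_measure R]_(x in `]0, +oo[) (x `^ (a - 1) * expR (- x)).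

Definition chi2_pdf (m : nat) (x : R) : R :=
  if 0 < x then
    x `^ (m%:R / 2 - 1) * expR (- (x / 2)) /
    (2 `^ (m%:R / 2) * Gamma (m%:R / 2))
  else 0.

Definition chi2_prob (m : nat) (A : set R) : \bar R :=
  (\int[@lebesgue_measure R]_(x in A) (chi2_pdf m x)%:E)%E.

(* The law of c * V for V with the chi-square law. *)
Definition scaled_chi2_prob (c : R) (m : nat) (A : set R) : \bar R :=
  chi2_prob m [set x | A (c * x)].

End distributions.

Record parameter (R : realType) (p q : nat) := MkParameter {
  theta1 : p.-tuple R;
  theta2 : q.-tuple R;
  sigma1 : R;
  sigma2 : R }.

Definition admissible (R : realType) (p q : nat) (par : parameter R p q) :=
  [/\ 0 < sigma1 par, 0 < sigma2 par & sigma1 par <= sigma2 par].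

(* The joint law of (tau, X1, S1, X2, S2) disintegrated along tau: given
   tau = t, it is the product of the four conditional laws. The case
   B1 = C1 = B2 = C2 = setT says that tau has law Pi. *)
Definition scale_mixture_model (R : realType) (p q m1 m2 : nat)
    (Pi : probability R R) (d : measure_display) (Omega : measurableType d)
    (P : parameter R p q -> probability Omega R)
    (tau : {mfun Omega >-> R})
    (X1 : {mfun Omega >-> p.-tuple R}) (S1 : {mfun Omega >-> R})
    (X2 : {mfun Omega >-> q.-tuple R}) (S2 : {mfun Omega >-> R}) : Prop :=
  forall par, admissible par ->
  forall (A : set R) (B1 : set (p.-tuple R)) (C1 : set R)
    (B2 : set (q.-tuple R)) (C2 : set R),
  measurable A -> measurable B1 -> measurable C1 ->
  measurable B2 -> measurable C2 ->
  P par [set w | [/\ A (tau w), B1 (X1 w), C1 (S1 w), B2 (X2 w) & C2 (S2 w)]]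
  = (\int[Pi]_(t in A `&` `]0%R, +oo[)
       (mvnormal_prob (theta1 par) ((sigma1 par) ^+ 2 / t)%R B1 *
        scaled_chi2_prob ((sigma1 par) ^+ 2 / t)%R m1 C1 *
        mvnormal_prob (theta2 par) ((sigma2 par) ^+ 2 / t)%R B2 *
        scaled_chi2_prob ((sigma2 par) ^+ 2 / t)%R m2 C2))%E.

Definition entropy_loss (R : realType) (delta s2 : R) : R :=
  delta / s2 - ln (delta / s2) - 1.

Section risk.
Context {R : realType} {p q : nat} {d : measure_display}
  {Omega : measurableType d} (P : parameter R p q -> probability Omega R).

Definition risk (delta : Omega -> R) (par : parameter R p q) : \bar R :=
  'E_(P par)[fun w => entropy_loss (delta w) ((sigma1 par) ^+ 2)].

Definition dominates (delta' delta : Omega -> R) : Prop :=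
  (forall par, admissible par -> (risk delta' par <= risk delta par)%E) /\
  (exists par, admissible par /\ (risk delta' par < risk delta par)%E).

End risk.

Definition mean_inv (R : realType) (Pi : probability R R) : \bar R :=
  'E_Pi[fun t : R => t^-1].

Definition phi11E (R : realType) (m1 m2 : nat) (Pi : probability R R)
    (z : R) : R :=
  (1 + z) / ((m1 + m2)%:R * fine (mean_inv Pi)).

(* Main.v *)
Require Import Defs.
From HB Require Import structures.
From mathcomp Require Import all_boot all_order all_algebra.
From mathcomp Require Import all_classical all_reals all_analysis.
From mathcomp Require Import measurable_realfun ring lra.

Set Implicit Arguments.
Unset Strict Implicit.
Unset Printing Implicit Defensive.

Import Order.TTheory GRing.Theory Num.Theory.
Import numFieldNormedType.Exports.

Local Open Scope classical_set_scope.
Local Open Scope ring_scope.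

(**
  Put [s = S1 / sigma1^2], [Z = S2 / S1], [phi2 = phi11E] and
  [B = {phi2(Z) < phi1(Z)}].
  Truncation changes the loss only on [B], where it gains
  [(phi1 - phi2) s - ln (phi1 / phi2)], so it suffices that
  [E[(phi1 - phi2) s 1_B] >= E[(phi1 / phi2 - 1) 1_B]], because [ln x < x - 1] for
  [x > 1].  Given [tau], [S1] and [S2] are [sigma_i^2 / tau] times independent
  chi-squares [V1], [V2], hence [Z = r V2 / V1] with [r = sigma2^2 / sigma1^2]
  does not involve [tau], and
  [E[s | Z] = E[1/tau] E[V1 | V2 / V1] = E[1/tau] (m1 + m2) / (1 + Z / r)].
  As [r >= 1], this is at least [E[1/tau] (m1 + m2) / (1 + Z) = 1 / phi2(Z)].

  The value of [E[V1 | V2 / V1]] comes from the substitution [y = x u] in the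
  double integral and the recurrence
  [int x^s e^(-l x) = (s / l) int x^(s-1) e^(-l x)], in which the normalizing
  constants of the chi-square densities play no role.
*)

(** * Measurability of the inverse, and measures with a density *)

(** The square makes the base of [powR] nonnegative for either sign of x, and the outer factor x
    yields the convention [0^-1 = 0]. *)
Lemma measurable_invr (R : realType) : measurable_fun [set: R] (fun x : R => x^-1).
Proof.
rewrite (_ : (fun x => _) = (fun x : R => x * (x ^+ 2) `^ (-1))).
  apply: measurable_funM => //; apply: (measurableT_comp (measurable_powR (-1))).
  exact: exprn_measurable.
apply/funext => x; have [->|x0] := eqVneq x 0; first by rewrite invr0 mul0r.
by rewrite powR_inv1 ?sqr_ge0// expr2 invfM mulrA divff// mul1r.
Qed.

(** Both hypotheses on f are arguments, so that the measure structure declared below can be inferred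
    from the term alone. *)
Definition mdensity d (T : measurableType d) (R : realType)
    (mu : {measure set T -> \bar R}) (f : T -> R)
    of measurable_fun [set: T] f & (forall x, 0 <= f x) : set T -> \bar R :=
  fun A => (\int[mu]_(x in A) (f x)%:E)%E.

Section mdensity.
Local Open Scope ereal_scope.
Context d (T : measurableType d) (R : realType).
Variables (mu : {measure set T -> \bar R}) (f : T -> R).
Hypotheses (mf : measurable_fun [set: T] f) (f0 : forall x, (0 <= f x)%R).

Local Notation nu := (mdensity mu mf f0).

Let nu0 : nu set0 = 0.
Proof. by rewrite /mdensity integral_set0. Qed.

Let nu_ge0 A : 0 <= nu A.
Proof. by apply: integral_ge0 => x _; rewrite lee_fin. Qed.

Let nu_sigma_additive : semi_sigma_additive nu.
Proof.
move=> /= F mF tF mUF; rewrite /mdensity; apply: cvg_toP.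
  apply: ereal_nondecreasing_is_cvgn => m n mn.
  by apply: lee_sum_nneg_natr => // k _ _; apply: integral_ge0 => x _; rewrite lee_fin.
by rewrite ge0_integral_bigcup//= => [|x _]; [exact/measurable_EFinP/measurable_funTS|rewrite lee_fin].
Qed.

HB.instance Definition _ := isMeasure.Build _ _ _ nu
  nu0 nu_ge0 nu_sigma_additive.

Import HBNNSimple.

Let integral_nnsfun (h : {nnsfun T >-> R}) :
  \int[nu]_x (h x)%:E = \int[mu]_x ((h x)%:E * (f x)%:E).
Proof.
transitivity (\sum_(k \in range h)
    \int[nu]_x (k * \1_(h @^-1` [set k]) x)%:E).
  under eq_integral do rewrite fimfunE -fsumEFin//.
  rewrite ge0_integral_fsum//.
  - by move=> r; exact/measurable_EFinP/measurable_funM.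
  - by move=> r x _; rewrite nnfun_muleindic_ge0.
transitivity (\sum_(k \in range h)
    \int[mu]_x ((k * \1_(h @^-1` [set k]) x)%:E * (f x)%:E)).
  apply: eq_fsbigr => r /[!inE] -[x _ <-].
  rewrite integralZl_indic_nnsfun// integral_indic// setIT.
  under [RHS]eq_integral do rewrite EFinM -muleA.
  rewrite [RHS]ge0_integralZl//; last 3 first.
  - by apply: emeasurable_funM; exact/measurable_EFinP.
  - by move=> y _; rewrite mule_ge0// lee_fin.
  - by rewrite lee_fin.
  congr *%E; rewrite /= /mdensity integral_mkcond; apply: eq_integral => y _.
  by rewrite patchE indicE; case: ifPn; rewrite ?mul1e ?mul0e.
rewrite -ge0_integral_fsum//.
- apply: eq_integral => x _; rewrite -ge0_mule_fsuml ?fsumEFin// -?fimfunE//.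
  by move=> r; rewrite nnfun_muleindic_ge0.
- move=> r; apply: emeasurable_funM; last exact/measurable_EFinP.
  exact/measurable_EFinP/measurable_funM.
- by move=> r x _; rewrite mule_ge0 ?nnfun_muleindic_ge0// lee_fin.
Qed.

(** Monotone convergence along simple functions reduces this to indicators of fibres, where it is
    the definition of [nu]. *)
Lemma ge0_integral_mdensity (g : T -> \bar R) :
  measurable_fun [set: T] g -> (forall x, 0 <= g x) ->
  \int[nu]_x g x = \int[mu]_x (g x * (f x)%:E).
Proof.
move=> mg g0; pose g_ := nnsfun_approx measurableT mg.
have cvg_g x : (g_ n x)%:E @[n --> \oo] --> g x by exact: cvg_nnsfun_approx.
transitivity (limn (fun n => \int[nu]_x (g_ n x)%:E)).
  rewrite -monotone_convergence//.
  - by apply: eq_integral => x _; exact/esym/cvg_lim.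
  - by move=> n; exact/measurable_EFinP.
  - by move=> n y _; rewrite lee_fin.
  - by move=> y _ m n mn; rewrite lee_fin; exact/lefP/nd_nnsfun_approx.
under eq_fun do rewrite integral_nnsfun.
rewrite -monotone_convergence//.
- apply: eq_integral => x _; apply/cvg_lim => //.
  rewrite muleC; under eq_fun do rewrite muleC.
  exact: cvgeZl.
- by move=> n; apply: emeasurable_funM; exact/measurable_EFinP.
- by move=> n y _; rewrite mule_ge0// lee_fin.
- move=> y _ m n mn; apply: lee_wpmul2r; rewrite lee_fin//.
  exact/lefP/nd_nnsfun_approx.
Qed.

End mdensity.

(** * Scaling of Lebesgue measure on the line *)

Section scaling.
Local Open Scope ereal_scope.
Context (R : realType).
Local Notation mu := (@lebesgue_measure R).

(** The image of [mu] under multiplication by c, rescaled by c, gives an interval []a, b]] the mass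
    c (b / c - a / c) = b - a, hence is [mu] by uniqueness. *)
Lemma ge0_integral_scale (c : R) (f : R -> \bar R) : (0 < c)%R ->
  measurable_fun [set: R] f -> (forall x, 0 <= f x) ->
  \int[mu]_x f x = c%:E * \int[mu]_x f (c * x)%R.
Proof.
move=> c0 mf f0.
pose sc : measurableTypeR R -> measurableTypeR R := fun x => (c * x)%R.
have msc : measurable_fun setT sc by exact: mulrl_measurable.
(* The pushforward is abstracted into [nu], of which only the values and this one integral are
   kept. *)
have [nu nuE ->] : exists2 nu : {measure set (measurableTypeR R) -> \bar R},
    nu = pushforward mu sc :> (set _ -> \bar R) &
    \int[mu]_x f (c * x)%R = \int[nu]_x f x.
  unshelve eexists (pushforward mu sc : {measure set _ -> \bar R}) => //.
  by rewrite ge0_integral_pushforward.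
rewrite -(ge0_integral_mscale nu measurableT (NngNum (ltW c0)))//.
apply: eq_measure_integral => A mA _.
apply: lebesgue_measure_unique => // _ [[a b]] _ <-.
rewrite /= /mscale/= nuE /pushforward.
rewrite (_ : _ @^-1` _ = `](a / c)%R, (b / c)%R]%classic); last first.
  apply/seteqP; split => x /=; rewrite !in_itv/=;
    by rewrite ltr_pdivrMr// ler_pdivlMr// mulrC.
rewrite !lebesgue_measure_itv/= !lte_fin ltr_pM2r ?invr_gt0//.
case: ifPn => _; last by rewrite mule0.
by rewrite -!EFinB -EFinM -mulrBl mulrCA divff ?gt_eqF// mulr1.
Qed.

End scaling.

(** * Total mass of the multivariate normal law *)

Lemma mvnormal_pdf_cons (R : realType) (n : nat) (a : R) (theta : n.-tuple R)
    (v x : R) (y : n.-tuple R) : 0 < v ->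
  mvnormal_pdf [tuple of a :: theta] v [tuple of x :: y] =
  normal_pdf a (Num.sqrt v) x * mvnormal_pdf theta v y.
Proof.
move=> v0; rewrite normal_pdfE ?gt_eqF ?sqrtr_gt0//.
rewrite /mvnormal_pdf /normal_peak /normal_fun sqr_sqrtr ?ltW//.
rewrite big_ord_recl !tnth0.
under eq_bigr do rewrite !tnthS.
have -> : v * pi *+ 2 = 2 * pi * v by rewrite -mulr_natl mulrA mulrAC -mulrA mulrA.
have c0 : 0 < 2 * pi * v by rewrite !mulr_gt0// pi_gt0.
rewrite -powR12_sqrt ?ltW// -powRN.
rewrite (_ : - (n.+1%:R / 2) = - (n%:R / 2) + - 2^-1); last first.
  by rewrite -natr1; ring.
rewrite powRD; last by rewrite (gt_eqF c0) implybT.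
by rewrite [X in expR (X / _)]opprD [X in expR X]mulrDl expRD (mulr_natl v 2); ring.
Qed.

(** The estimators depend on [S1] and [S2] only; this is what removes the two normal factors from
    the model. *)
Lemma mvnormal_probT (R : realType) (n : nat) (theta : n.-tuple R) (v : R) :
  0 < v -> mvnormal_prob theta v setT = 1%E.
Proof.
move=> v0; rewrite /mvnormal_prob.
(* The constant a makes the induction work: the density of the first coordinate is absorbed into it
   before the inner integral is evaluated. *)
suff H (a : R) : 0 <= a ->
    integral_Rn (fun x => (a * mvnormal_pdf theta v x)%:E) = a%:E.
  rewrite -(H 1)//; congr (integral_Rn _); apply/funext => x.
  by rewrite indicT mulr1 mul1r.
elim: n theta a => [|n IH] theta a a0 /=.
  by rewrite /mvnormal_pdf big_ord0 oppr0 !mul0r expR0 oppr0 powRr0 !mulr1.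
case/tupleP: theta => t theta.
under eq_integral => x _.
  under [X in integral_Rn X]eq_fun => y.
    rewrite mvnormal_pdf_cons// mulrA; over.
  rewrite IH ?mulr_ge0 ?normal_pdf_ge0// EFinM; over.
rewrite ge0_integralZl//; last 2 first.
- by apply/measurable_EFinP; exact: measurable_normal_pdf.
- by move=> x _; rewrite lee_fin normal_pdf_ge0.
by rewrite integral_normal_pdf mule1.
Qed.

(** * The recurrence for gamma integrals *)

Section gamma_recurrence.
Context (R : realType).
Local Notation mu := (@lebesgue_measure R).

Lemma continuous_powR (p x : R) : 0 < x -> {for x, continuous (fun y : R => y `^ p)}.
Proof.
move=> x0; apply: differentiable_continuous; apply/derivable1_diffP.
by apply: derivable_powR; rewrite in_itv/= x0.
Qed.

(** For p = 0 the function is constantly 1, its [powR] value at 0 included; this case occurs below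
    when s = 1. *)
Lemma cvg_at_right0_powR (p : R) : 0 <= p -> y `^ p @[y --> 0^'+] --> (0 : R) `^ p.
Proof.
rewrite le_eqVlt => /predU1P[<-|p0]; last first.
  by rewrite powR0 ?gt_eqF//; exact: powR_cvg0.
by under eq_fun do rewrite powRr0; rewrite powRr0; exact: cvg_cst.
Qed.

Lemma within_continuous_powR (c p b : R) : 0 <= p -> 0 < b ->
  {within `[0, b], continuous (fun y : R => c * y `^ p)}.
Proof.
move=> p0 b0; apply/continuous_within_itvP => //; split.
- move=> x; rewrite in_itv/= => /andP[x0 _].
  by apply: cvgM; [exact: cvg_cst|exact: continuous_powR].
- by apply: cvgM; [exact: cvg_cst|exact: cvg_at_right0_powR].
- apply: cvgM; first exact: cvg_cst.
  by apply: cvg_at_left_filter; exact: continuous_powR.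
Qed.

(** With [integral_expR_tail], this gives the inner integrals of the Tonelli argument below. The
    bound s >= 1 keeps the integrand continuous up to 0. *)
Lemma integral_powR (s b : R) : 1 <= s -> 0 <= b ->
  (\int[mu]_(x in `[0%R, b]) (s * x `^ (s - 1))%:E = (b `^ s)%:E)%E.
Proof.
move=> s1; have s0 : 0 < s by exact: lt_le_trans s1.
rewrite le_eqVlt => /predU1P[<-|b0].
  by rewrite set_itv1 integral_set1 powR0// gt_eqF.
rewrite (@continuous_FTC2 _ _ (fun x => x `^ s))//.
- by rewrite powR0 ?gt_eqF// sube0.
- by apply: within_continuous_powR => //; rewrite subr_ge0.
- split.
  + move=> x; rewrite in_itv/= => /andP[x0 _].
    by apply: derivable_powR; rewrite in_itv/= x0.
  + exact/cvg_at_right0_powR/ltW.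
  + by apply: cvg_at_left_filter; exact: continuous_powR.
- move=> x; rewrite in_itv/= => /andP[x0 _].
  by rewrite powR_derive1// in_itv/= x0.
Qed.

Lemma integral_expR_tail (l a : R) : 0 < l ->
  (\int[mu]_(y in `[a, +oo[) (l * expR (- (l * y)))%:E = (expR (- (l * a)))%:E)%E.
Proof.
move=> l0.
have cexp : continuous (fun y : R => expR (- (l * y))).
  move=> z; apply: continuous_comp; last exact: continuous_expR.
  apply: (@continuousN _ R^o).
  by apply: (@continuousM _ R^o) => //; exact: cst_continuous.
rewrite (@ge0_continuous_FTC2y _ _ (fun y => - expR (- (l * y))) _ 0)//.
- by rewrite sub0e EFinN oppeK.
- by move=> x _; rewrite mulr_ge0 ?expR_ge0 ?ltW.
- apply: continuous_subspaceT => x.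
  by apply: cvgM; [exact: cvg_cst|exact: cexp].
- rewrite -oppr0; apply: cvgN.
  apply: (@cvg_comp _ _ _ ( *%R l) (fun z => expR (- z)) _ (pinfty_nbhs R)).
    exact: gt0_cvgMry.
  exact: cvgr_expR.
- by apply: cvgN; apply/cvg_at_right_filter; exact: cexp.
- move=> x _; rewrite derive1E derive_val /GRing.scale/=; ring.
Qed.

(* Tonelli on [0 <= x <= y] for [s x^(s-1) * l e^(-l y)]: unlike integration by
   parts, this needs neither finiteness nor decay at infinity. *)
Lemma integral_gamma_recurrence (s l : R) : 1 <= s -> 0 < l ->
  (\int[mu]_(x in `[0%R, +oo[) (x `^ s * expR (- (l * x)))%:E =
   (s / l)%:E *
   \int[mu]_(x in `[0%R, +oo[) (x `^ (s - 1) * expR (- (l * x)))%:E)%E.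
Proof.
move=> s1 l0; have s0 : 0 < s by exact: lt_le_trans s1.
pose G (z : R * R) : \bar R := (if (0 <= z.1) && (z.1 <= z.2) then
  (s * z.1 `^ (s - 1)) * (l * expR (- (l * z.2))) else 0)%:E.
have mpowR (c p : R) : measurable_fun [set: R] (fun x : R => c * x `^ p).
  by apply: measurable_funM => //; exact: measurable_powR.
have mexpR : measurable_fun [set: R] (fun x : R => expR (- (l * x))).
  by apply: measurableT_comp => //; apply: measurableT_comp.
have mG : measurable_fun [set: R * R] G.
  apply/measurable_EFinP; apply: measurable_fun_ifT => //.
    by apply: measurable_and; exact: measurable_fun_ler.
  apply: measurable_funM; first exact: (measurableT_comp (mpowR _ _)).
  by apply: measurable_funM => //; exact: (measurableT_comp mexpR).
have G0 z : (0 <= G z)%E.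
  by rewrite lee_fin; case: ifP => _//; rewrite !mulr_ge0 ?powR_ge0 ?expR_ge0 ?ltW.
have := fubini_tonelli (m1 := mu) (m2 := mu) G mG G0.
(* Integrating first over y in [[x, +oo[] leaves s x^(s-1) e^(-l x). *)
have -> : (\int[mu]_x \int[mu]_y G (x, y) =
  s%:E * \int[mu]_(x in `[0%R, +oo[) (x `^ (s - 1) * expR (- (l * x)))%:E)%E.
  rewrite -ge0_integralZl//; last 3 first.
  - by apply/measurable_EFinP/measurable_funTS/measurable_funM.
  - by move=> x _; rewrite lee_fin mulr_ge0 ?powR_ge0 ?expR_ge0.
  - by rewrite lee_fin ltW.
  rewrite [RHS]integral_mkcond; apply: eq_integral => x _.
  rewrite patchE mem_setE in_itv/= andbT; case: ifPn => x0; last first.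
    by rewrite integral0_eq// => y _; rewrite /G/= (negbTE x0).
  rewrite -EFinM mulrA EFinM -integral_expR_tail// -ge0_integralZl//; last 3 first.
  - exact/measurable_EFinP/measurable_funTS/measurable_funM.
  - by move=> y _; rewrite lee_fin mulr_ge0 ?expR_ge0 ?ltW.
  - by rewrite lee_fin mulr_ge0 ?powR_ge0 ?ltW.
  rewrite [RHS]integral_mkcond; apply: eq_integral => y _.
  by rewrite patchE mem_setE in_itv/= andbT /G/= x0/=; case: ifP.
(* Integrating first over x in [[0, y]] leaves l y^s e^(-l y). *)
have -> : (\int[mu]_y \int[mu]_x G (x, y) =
  l%:E * \int[mu]_(x in `[0%R, +oo[) (x `^ s * expR (- (l * x)))%:E)%E.
  rewrite -ge0_integralZl//; last 3 first.
  - by apply/measurable_EFinP/measurable_funTS/measurable_funM.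
  - by move=> x _; rewrite lee_fin mulr_ge0 ?powR_ge0 ?expR_ge0.
  - by rewrite lee_fin ltW.
  rewrite [RHS]integral_mkcond; apply: eq_integral => y _.
  rewrite patchE mem_setE in_itv/= andbT; case: ifPn => y0; last first.
    rewrite integral0_eq// => x _; rewrite /G/=; case: ifP => // /andP[x0 xy].
    by rewrite (le_trans x0 xy) in y0.
  rewrite -EFinM mulrCA EFinM -integral_powR// -ge0_integralZr//; last 3 first.
  - by apply/measurable_EFinP/measurable_funTS; exact: mpowR.
  - by move=> x _; rewrite lee_fin mulr_ge0 ?powR_ge0 ?ltW.
  - by rewrite lee_fin mulr_ge0 ?expR_ge0 ?ltW.
  rewrite [RHS]integral_mkcond; apply: eq_integral => x _.
  by rewrite patchE mem_setE in_itv/= /G/=; case: ifP.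
move=> /(congr1 (fun z => (l^-1)%:E * z)%E).
by rewrite !muleA -!EFinM mulVf ?gt_eqF// mul1e mulrC => <-.
Qed.

End gamma_recurrence.

(** * Chi-square densities and the ratio of two independent chi-squares *)

Section chi2_density.
Context (R : realType).
Local Notation mu := (@lebesgue_measure R).

Lemma Gamma_ge0 (a : R) : 0 <= Gamma a.
Proof.
by apply: Rintegral_ge0 => x _; rewrite mulr_ge0 ?powR_ge0 ?expR_ge0.
Qed.

Lemma chi2_pdf_ge0 m (x : R) : 0 <= chi2_pdf m x.
Proof.
rewrite /chi2_pdf; case: ifP => // _.
by rewrite divr_ge0 ?mulr_ge0 ?powR_ge0 ?expR_ge0 ?Gamma_ge0.
Qed.

Lemma chi2_pdf_le0 m (x : R) : x <= 0 -> chi2_pdf m x = 0.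
Proof. by rewrite /chi2_pdf leNgt => /negbTE ->. Qed.

Lemma measurable_chi2_pdf m : measurable_fun [set: R] (chi2_pdf m).
Proof.
apply: measurable_fun_ifT => //; first exact: measurable_fun_ltr.
apply: measurable_funM => //; apply: measurable_funM.
  exact: measurable_powR.
by apply: measurableT_comp => //; apply: measurableT_comp => //; exact: measurable_funM.
Qed.

(** Passes from whole-line integrals of functions supported on the positive axis to the half-line
    integrals of the gamma recurrence; the endpoint 0 is a null set. *)
Lemma ge0_integral_pos_support (g h : R -> R) (C : R) : 0 <= C ->
  measurable_fun [set: R] h -> (forall x, 0 <= h x) ->
  (forall x, x <= 0 -> g x = 0) -> (forall x, 0 < x -> g x = C * h x) ->
  (\int[mu]_x (g x)%:E = C%:E * \int[mu]_(x in `[0%R, +oo[) (h x)%:E)%E.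
Proof.
move=> C0 mh h0 gN gP; rewrite -integral_itv_obnd_cbnd; last first.
  exact/measurable_EFinP/measurable_funTS.
rewrite -ge0_integralZl//; last 2 first.
  exact/measurable_EFinP/measurable_funTS.
  by move=> x _; rewrite lee_fin.
rewrite [RHS]integral_mkcond; apply: eq_integral => x _.
rewrite patchE mem_setE in_itv/= andbT; case: ltP => x0; first by rewrite gP.
by rewrite gN.
Qed.

(** This is E[V1 | V2 / V1 = u] = (m1 + m2) / (1 + u) before normalization: one factor |x| is the
    Jacobian of y = x u, the other is V1. For u > 0 the right integrand is C x^(s-1) e^(-l x) on x >
    0, with s = (m1 + m2) / 2 and l = (1 + u) / 2, and the recurrence contributes s / l. *)
Lemma integral_chi2_pdf_line m1 m2 (u : R) : (0 < m1)%N -> (0 < m2)%N ->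
  (\int[mu]_x (`|x| * `|x| * chi2_pdf m1 x * chi2_pdf m2 (x * u))%:E =
   ((m1 + m2)%:R / (1 + `|u|))%:E *
   \int[mu]_x (`|x| * chi2_pdf m1 x * chi2_pdf m2 (x * u))%:E)%E.
Proof.
(* For u <= 0 one of the two densities vanishes at every x. *)
move=> m10 m20; have [u0|u0] := leP u 0.
  have E x : chi2_pdf m1 x * chi2_pdf m2 (x * u) = 0.
    have [x0|x0] := leP x 0; first by rewrite chi2_pdf_le0// mul0r.
    by rewrite [X in _ * X]chi2_pdf_le0 ?mulr0// mulr_ge0_le0// ltW.
  by rewrite !integral0_eq ?mule0// => x _; rewrite -mulrA E mulr0.
pose s : R := m1%:R / 2 + m2%:R / 2.
pose l : R := (1 + u) / 2.
pose C : R := u `^ (m2%:R / 2 - 1) / (2 `^ (m1%:R / 2) * Gamma (m1%:R / 2)) /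
  (2 `^ (m2%:R / 2) * Gamma (m2%:R / 2)).
have C0 : 0 <= C by rewrite !divr_ge0 ?mulr_ge0 ?powR_ge0 ?Gamma_ge0.
have s1 : 1 <= s.
  have : 1 <= m1%:R :> R by rewrite ler1n.
  have : 1 <= m2%:R :> R by rewrite ler1n.
  by rewrite /s; lra.
have l0 : 0 < l by rewrite /l; lra.
have key x : 0 < x -> x * chi2_pdf m1 x * chi2_pdf m2 (x * u) =
    C * (x `^ (s - 1) * expR (- (l * x))).
  move=> x0; rewrite /chi2_pdf x0 mulr_gt0// /C powRM ?(ltW x0) ?(ltW u0)//.
  rewrite (_ : s - 1 = 1 + (m1%:R / 2 - 1) + (m2%:R / 2 - 1)); last by rewrite /s; ring.
  have pD p q : x `^ (p + q) = x `^ p * x `^ q.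
    by rewrite powRD// (gt_eqF x0) implybT.
  rewrite (pD _ (m2%:R / 2 - 1)) (pD 1) powRr1 ?(ltW x0)//.
  rewrite (_ : - (l * x) = - (x / 2) - (x * u / 2)); last by rewrite /l; field.
  by rewrite expRD; ring.
have mexp : measurable_fun [set: R] (fun x : R => expR (- (l * x))).
  by apply: measurableT_comp => //; apply: measurableT_comp.
have mp p : measurable_fun [set: R] (fun x : R => x `^ p * expR (- (l * x))).
  by apply: measurable_funM => //; exact: measurable_powR.
have p0 p x : 0 <= x `^ p * expR (- (l * x)).
  by rewrite mulr_ge0 ?powR_ge0 ?expR_ge0.
rewrite (ge0_integral_pos_support C0 (mp s) (p0 s)); last 2 first.
- by move=> x x0; rewrite (chi2_pdf_le0 _ x0) mulr0 mul0r.
- move=> x x0; rewrite gtr0_norm//.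
  transitivity (x * (x * chi2_pdf m1 x * chi2_pdf m2 (x * u))); first by ring.
  by rewrite key// -(mulr_powRB1 (ltW x0) (lt_le_trans _ s1))//; ring.
rewrite (ge0_integral_pos_support C0 (mp (s - 1)) (p0 (s - 1))); last 2 first.
- by move=> x x0; rewrite (chi2_pdf_le0 _ x0) mulr0 mul0r.
- by move=> x x0; rewrite gtr0_norm// key.
rewrite integral_gamma_recurrence// (gtr0_norm u0) muleCA; congr (_%:E * _)%E.
by rewrite /s /l natrD; field; lra.
Qed.

(** Substitution y = x u for each x > 0, then Tonelli. The weight k will be |x| on one side of the
    conditional mean identity and 1 on the other. *)
Lemma integral_ratio m1 m2 (h k : R -> R) :
  measurable_fun [set: R] h -> measurable_fun [set: R] k ->
  (forall x, 0 <= h x) -> (forall x, 0 <= k x) ->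
  (\int[mu]_x \int[mu]_y (h (y / x) * (k x * chi2_pdf m1 x * chi2_pdf m2 y))%:E =
   \int[mu]_u ((h u)%:E *
     \int[mu]_x (`|x| * k x * chi2_pdf m1 x * chi2_pdf m2 (x * u))%:E))%E.
Proof.
move=> mh mk h0 k0.
have mc m := measurable_chi2_pdf m.
have c0 m x := chi2_pdf_ge0 m x.
pose G (z : R * R) := (h z.2 *
  (`|z.1| * k z.1 * chi2_pdf m1 z.1 * chi2_pdf m2 (z.1 * z.2)))%:E.
have mG : measurable_fun [set: R * R] G.
  apply/measurable_EFinP; apply: measurable_funM.
    exact: (measurableT_comp mh).
  apply: measurable_funM.
    apply: measurable_funM; last exact: (measurableT_comp (mc _)).
    apply: measurable_funM; last exact: (measurableT_comp mk).
    exact: measurableT_comp.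
  by apply: (measurableT_comp (mc _)); exact: measurable_funM.
have G0 z : (0 <= G z)%E by rewrite lee_fin !mulr_ge0.
transitivity (\int[mu]_x \int[mu]_u G (x, u))%E.
  apply: eq_integral => x _; have [x0|x0] := leP x 0.
    by rewrite !integral0_eq// => y _; rewrite /G/= chi2_pdf_le0// !(mulr0,mul0r).
  rewrite (@ge0_integral_scale _ x)//; last 2 first.
  - apply/measurable_EFinP; apply: measurable_funM => //.
      by apply: (measurableT_comp mh); exact: measurable_funM.
    exact: measurable_funM.
  - by move=> y; rewrite lee_fin !mulr_ge0.
  rewrite -ge0_integralZl//; last 3 first.
  - apply/measurable_EFinP; apply: measurable_funM => //.
      by apply: (measurableT_comp mh); exact: measurable_funM.
    by apply: measurable_funM => //; apply: measurableT_comp => //; exact: measurable_funM.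
  - by move=> y _; rewrite lee_fin !mulr_ge0.
  - by rewrite lee_fin ltW.
  apply: eq_integral => u _; rewrite -EFinM /G/= gtr0_norm//.
  by rewrite [x * u]mulrC mulfK ?gt_eqF//; congr (_%:E); ring.
rewrite fubini_tonelli//; apply: eq_integral => u _.
rewrite -ge0_integralZl//.
- apply/measurable_EFinP; apply: measurable_funM; last first.
    by apply: (measurableT_comp (mc _)); exact: measurable_funM.
  by apply: measurable_funM; [exact: measurable_funM|exact: mc].
- by move=> x _; rewrite lee_fin !mulr_ge0.
- by rewrite lee_fin.
Qed.

(** Both sides become integrals over the ratio u, which [integral_chi2_pdf_line] compares for each
    u. *)
Lemma integral_chi2_ratio m1 m2 (h : R -> R) : (0 < m1)%N -> (0 < m2)%N ->
  measurable_fun [set: R] h -> (forall x, 0 <= h x) ->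
  (\int[mu]_x \int[mu]_y (h (y / x) * (`|x| * chi2_pdf m1 x * chi2_pdf m2 y))%:E =
   (m1 + m2)%:R%:E * \int[mu]_x \int[mu]_y
     (h (y / x) / (1 + `|y / x|) * (chi2_pdf m1 x * chi2_pdf m2 y))%:E)%E.
Proof.
move=> m10 m20 mh h0.
have den0 (u : R) : 0 < 1 + `|u| by rewrite ltr_pwDl.
have mden : measurable_fun [set: R] (fun u : R => h u / (1 + `|u|)).
  apply: measurable_funM => //; apply: (measurableT_comp (@measurable_invr R)).
  by apply: measurable_funD => //; exact: measurableT_comp.
(* The inserted factor 1 is the weight k of [integral_ratio]. *)
under [in RHS]eq_integral do under eq_integral do rewrite -(mul1r (chi2_pdf m1 _)).
rewrite integral_ratio// (integral_ratio _ _ (k := fun=> 1) mden)//; last first.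
  by move=> u; rewrite divr_ge0// ltW.
rewrite -ge0_integralZl//; last 2 first.
- apply: emeasurable_funM; first exact/measurable_EFinP.
  pose G (z : R * R) :=
    (`|z.1| * 1 * chi2_pdf m1 z.1 * chi2_pdf m2 (z.1 * z.2))%:E.
  have mG : measurable_fun [set: R * R] G.
    have mc m := measurable_chi2_pdf m.
    apply/measurable_EFinP; apply: measurable_funM; last first.
      by apply: (measurableT_comp (mc _)); exact: measurable_funM.
    apply: measurable_funM; last exact: (measurableT_comp (mc _)).
    by apply: measurable_funM => //; exact: measurableT_comp.
  have G0 z : (0 <= G z)%E by rewrite lee_fin !mulr_ge0 ?chi2_pdf_ge0.
  exact: (measurable_fun_fubini_tonelli_G (m1 := mu) G mG G0).
- move=> u _; apply: mule_ge0; first by rewrite lee_fin divr_ge0// ltW.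
  by apply: integral_ge0 => x _; rewrite lee_fin !mulr_ge0 ?chi2_pdf_ge0.
apply: eq_integral => u _; rewrite integral_chi2_pdf_line// !muleA -!EFinM.
under [in RHS]eq_integral do rewrite mulr1.
by congr (_%:E * _)%E; ring.
Qed.

End chi2_density.

(* An alias of the product measure, so that a sigma-finite structure can be
   attached to it. *)
Definition lebesgue2 {R : realType} :
    set (measurableTypeR R * measurableTypeR R) -> \bar R :=
  (@lebesgue_measure R \x @lebesgue_measure R)%E.

(** * Sigma-finiteness of Lebesgue measure on the plane *)

Section lebesgue2.
Context (R : realType).

HB.instance Definition _ := Measure.on (@lebesgue2 R).

Let lebesgue2_sigma_finite : sigma_finite setT (@lebesgue2 R).
Proof.
pose I n : set (measurableTypeR R) := `](- n%:R)%R, n%:R[%classic.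
have mI n : measurable (I n) by exact: measurable_itv.
have Ioo n : (@lebesgue_measure R (I n) < +oo)%E.
  by rewrite /I lebesgue_measure_itv/=; case: ifP; rewrite ltry.
exists (fun n => I n `*` I n).
  apply/esym/seteqP; split => // -[x y] _.
  pose n := (Num.truncn (Num.max `|x| `|y|)).+1.
  have : Num.max `|x| `|y| < n%:R by exact: truncnS_gt.
  rewrite gt_max => /andP[xn yn]; exists n => //.
  by split; rewrite /I/= in_itv/= -ltr_norml.
move=> n; split; first exact: measurableX.
rewrite /lebesgue2 product_measure1E//; apply: lte_mul_pinfty => //.
  by rewrite ge0_fin_numE//; exact: Ioo.
exact: Ioo.
Qed.

HB.instance Definition _ := Measure_isSigmaFinite.Build _ _ _ (@lebesgue2 R)
  lebesgue2_sigma_finite.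

End lebesgue2.

(** * The joint law of the two sample variances *)

Section sample_variances_law.
Local Open Scope ereal_scope.
Context (R : realType) (p q m1 m2 : nat) (Pi : probability R R).
Context (d : measure_display) (Omega : measurableType d).
Variables (P : parameter R p q -> probability Omega R).
Variables (tau : {mfun Omega >-> R}) (X1 : {mfun Omega >-> p.-tuple R})
  (S1 : {mfun Omega >-> R}) (X2 : {mfun Omega >-> q.-tuple R})
  (S2 : {mfun Omega >-> R}).
Hypothesis model : scale_mixture_model m1 m2 Pi P tau X1 S1 X2 S2.

Local Notation mu := (@lebesgue_measure R).
Local Notation base := (Pi \x @lebesgue2 R).

Let integral_base (H : R * (R * R) -> \bar R) :
  measurable_fun [set: R * (R * R)] H -> (forall z, 0 <= H z) ->
  \int[base]_z H z = \int[Pi]_t \int[mu]_x \int[mu]_y H (t, (x, y)).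
Proof.
move=> mH H0; rewrite (fubini_tonelli1 (m1 := Pi) (m2 := @lebesgue2 R) H mH H0).
apply: eq_integral => t _.
rewrite /fubini_F (fubini_tonelli1 (m1 := mu) (m2 := mu))//.
exact: measurableT_comp.
Qed.

(** Density with respect to [base] of (tau, V1, V2), where V1 and V2 are the underlying
    chi-squares. *)
Let weight (z : R * (R * R)) : R :=
  (\1_(`]0%R, +oo[%classic : set R) z.1 *
   (chi2_pdf m1 z.2.1 * chi2_pdf m2 z.2.2))%R.

Let measurable_weight : measurable_fun [set: R * (R * R)] weight.
Proof.
apply: measurable_funM.
  by apply: measurableT_comp => //; exact: measurable_indic.
apply: measurable_funM.
  apply: (measurableT_comp (@measurable_chi2_pdf R m1)).
  exact: (measurableT_comp measurable_fst).
apply: (measurableT_comp (@measurable_chi2_pdf R m2)).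
exact: (measurableT_comp measurable_snd).
Qed.

Let weight_ge0 z : (0 <= weight z)%R.
Proof. by rewrite !mulr_ge0 ?chi2_pdf_ge0. Qed.

Variable par : parameter R p q.
Hypothesis adm : admissible par.
Local Notation c1 := (sigma1 par ^+ 2)%R.
Local Notation c2 := (sigma2 par ^+ 2)%R.

(** Recovers (S1, S2) from (tau, V1, V2). *)
Let rescale (z : R * (R * R)) : R * R := (c1 / z.1 * z.2.1, c2 / z.1 * z.2.2)%R.

Let measurable_rescale : measurable_fun [set: R * (R * R)] rescale.
Proof.
apply/measurable_fun_pair; apply: measurable_funM.
- apply: measurable_funM => //.
  exact: (measurableT_comp (@measurable_invr R)).
- exact: (measurableT_comp measurable_fst).
- apply: measurable_funM => //.
  exact: (measurableT_comp (@measurable_invr R)).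
- exact: (measurableT_comp measurable_snd).
Qed.

Let chi2_probE m (A : set R) : measurable A ->
  chi2_prob m A = \int[mu]_x (\1_A x * chi2_pdf m x)%:E.
Proof.
move=> mA; rewrite /chi2_prob integral_mkcond; apply: eq_integral => x _.
by rewrite patchE indicE; case: ifP; rewrite ?mul1r ?mul0r.
Qed.

(** The model is taken at [setT] for tau and for the normal vectors, whose factors are then 1; the
    two chi-square probabilities combine into one double integral. *)
Let law_rect (C1 C2 : set R) : measurable C1 -> measurable C2 ->
  P par [set w | C1 (S1 w) /\ C2 (S2 w)] =
  \int[base]_(z in rescale @^-1` (C1 `*` C2)) (weight z)%:E.
Proof.
move=> mC1 mC2.
have [s10 s20 _] := adm.
have := model adm measurableT measurableT mC1 measurableT mC2.
rewrite setTI (_ : [set w | _] = [set w | C1 (S1 w) /\ C2 (S2 w)]); last first.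
  by apply/seteqP; split => w /= []//.
move=> ->.
have mpre (c t : R) (C : set R) : measurable C -> measurable [set x | C (c / t * x)%R].
  move=> mC; rewrite -[X in measurable X]setTI.
  exact: (measurable_funM (measurable_cst (c / t)%R) (@measurable_id _ _ setT)).
rewrite [RHS]integral_mkcond integral_base; last 2 first.
- apply/(measurable_restrictT _ _).1; last exact/measurable_EFinP/measurable_funTS.
  by rewrite -[X in measurable X]setTI; apply: measurable_rescale => //; exact: measurableX.
- by move=> z; rewrite patchE; case: ifP => // _; rewrite lee_fin.
rewrite [LHS]integral_mkcond; apply: eq_integral => t _.
rewrite patchE mem_setE in_itv/= andbT; case: ltP => t0; last first.
  rewrite integral0_eq// => x _; rewrite integral0_eq// => y _.
  rewrite patchE; case: ifP => // _; rewrite /weight/= indicE mem_setE.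
  by rewrite in_itv/= ltNge t0/= mul0r.
rewrite !mvnormal_probT ?divr_gt0 ?exprn_gt0// mule1 mul1e.
rewrite /scaled_chi2_prob !chi2_probE; try exact: mpre.
rewrite -ge0_integralZr//; last 3 first.
- apply/measurable_EFinP; apply: measurable_funM; last exact: measurable_chi2_pdf.
  by apply: measurable_indic; exact: mpre.
- by move=> x _; rewrite lee_fin mulr_ge0// chi2_pdf_ge0.
- by apply: integral_ge0 => x _; rewrite lee_fin mulr_ge0// chi2_pdf_ge0.
apply: eq_integral => x _.
rewrite -ge0_integralZl//; last 3 first.
- apply/measurable_EFinP; apply: measurable_funM; last exact: measurable_chi2_pdf.
  by apply: measurable_indic; exact: mpre.
- by move=> y _; rewrite lee_fin mulr_ge0// chi2_pdf_ge0.
- by rewrite lee_fin mulr_ge0// chi2_pdf_ge0.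
apply: eq_integral => y _.
rewrite patchE /weight/= !indicE -EFinM mem_setE in_itv/= t0 mul1r.
have -> : ((t, (x, y)) \in rescale @^-1` (C1 `*` C2)) =
    (x \in [set x | C1 (c1 / t * x)%R]) && (y \in [set x | C2 (c2 / t * x)%R]).
  by apply/idP/andP; rewrite !inE.
by do 2 case: (_ \in _); rewrite /= ?mul1r ?mul0r ?mulr0.
Qed.

(** The law of (S1, S2) and the image under [rescale] of the measure with density [weight] agree on
    rectangles by [law_rect]. Rectangles form a generating class stable under intersection, so the
    two measures, and the integrals of F, coincide. *)
Lemma sample_variances_law (F : R * R -> \bar R) :
  measurable_fun [set: R * R] F -> (forall z, 0 <= F z) ->
  \int[P par]_w F (S1 w, S2 w) = \int[Pi]_t \int[mu]_x \int[mu]_y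
    (F (c1 / t * x, c2 / t * y)%R *
     (\1_(`]0%R, +oo[%classic : set R) t * (chi2_pdf m1 x * chi2_pdf m2 y))%:E).
Proof.
move=> mF F0.
pose S w := (S1 w, S2 w).
have mS : measurable_fun [set: Omega] S by exact/measurable_fun_pair.
have [nu nuE nuF] : exists2 nu : {measure set (R * R) -> \bar R},
    forall A, nu A = P par (S @^-1` A) &
    \int[P par]_w F (S1 w, S2 w) = \int[nu]_x F x.
  unshelve eexists (pushforward (P par) S : {measure set _ -> \bar R}) => //.
  by rewrite ge0_integral_pushforward.
have [nu' nu'E nu'F] : exists2 nu' : {measure set (R * R) -> \bar R},
    forall A, nu' A = mdensity base measurable_weight weight_ge0 (rescale @^-1` A) &
    \int[mdensity base measurable_weight weight_ge0]_z F (rescale z) =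
    \int[nu']_x F x.
  unshelve eexists (pushforward
    (mdensity base measurable_weight weight_ge0) rescale : {measure set _ -> \bar R}) => //.
  by rewrite ge0_integral_pushforward.
transitivity (\int[nu']_x F x).
  rewrite nuF; apply: eq_measure_integral => A mA _.
  pose G : set (set (R * R)) :=
    [set C | exists A, measurable A /\ exists B, measurable B /\ C = A `*` B].
  apply: (measure_unique G (fun=> setT)) => //.
  - rewrite measurable_prod_measurableType //; congr (<<s _ >>).
    rewrite predeqE; split => [[B mB [C mC <-]]|[B [mB [C [mC ->]]]]].
      by exists B; split => //; exists C.
    by exists B => //; exists C.
  - move=> _ _ [Y1 [mY1 [Y2 [mY2 ->]]]] [Z1 [mZ1 [Z2 [mZ2 ->]]]].
    rewrite -setXI; exists (Y1 `&` Z1); split; first exact: measurableI.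
    by exists (Y2 `&` Z2); split => //; exact: measurableI.
  - by move=> _; exists setT; split => //; exists setT; split => //; rewrite setXTT.
  - by rewrite bigcup_const.
  - move=> _ [B [mB [C [mC ->]]]]; rewrite nuE nu'E; exact: law_rect.
  - by move=> _; rewrite nuE preimage_setT probability_setT ltry.
rewrite -nu'F ge0_integral_mdensity//; last exact: measurableT_comp.
rewrite integral_base//.
  apply: emeasurable_funM; first exact: measurableT_comp.
  exact/measurable_EFinP.
by move=> z; rewrite mule_ge0// lee_fin.
Qed.

End sample_variances_law.

(** * Null sets, and moments of the sample variances *)

Lemma measurable_set_bool d (T : measurableType d) (b : T -> bool) :
  measurable_fun [set: T] b -> measurable [set x | b x].
Proof.
by move=> mb; rewrite -[X in measurable X]setTI; exact: (mb _ [set true]).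
Qed.

Lemma integral_eq_off_null d (T : measurableType d) (R : realType)
    (mu : {measure set T -> \bar R}) (N : set T) (f g : T -> \bar R) :
  measurable N -> mu N = 0%E ->
  measurable_fun [set: T] f -> measurable_fun [set: T] g ->
  (forall x, ~ N x -> f x = g x) -> (\int[mu]_x f x = \int[mu]_x g x)%E.
Proof.
move=> mN N0 mf mg fg; apply: ae_eq_integral => //; exists N; split => //.
by move=> x /= fgx; apply: contrapT => /fg fgE; apply: fgx.
Qed.

(** The model integrates over []0, +oo[] while [mean_inv] integrates over the whole line; the
    complement is [Pi]-null. *)
Lemma integral_inv_mean_inv (R : realType) (Pi : probability R R) :
  Pi `]0, +oo[%classic = 1%E ->
  (\int[Pi]_(t in `]0%R, +oo[) (t^-1)%:E = mean_inv Pi)%E.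
Proof.
move=> Pi_pos; rewrite /mean_inv unlock integral_mkcond.
have Pi0 : Pi (~` `]0, +oo[%classic) = 0%E.
  by rewrite probability_setC// Pi_pos subee.
have mV : measurable_fun [set: R] (EFin \o (fun t : R => t^-1)).
  by apply/measurable_EFinP; exact: measurable_invr.
apply: (@integral_eq_off_null _ _ R Pi (~` `]0, +oo[%classic)) => //.
- exact: measurableC.
- apply: (measurable_restrictT _ _).1 => //; exact: (measurable_funTS mV).
- by move=> t /contrapT tP; rewrite patchE mem_set.
Qed.

Section sample_variances_moments.
Local Open Scope ereal_scope.
Context (R : realType) (p q m1 m2 : nat) (Pi : probability R R).
Context (d : measure_display) (Omega : measurableType d).
Variables (P : parameter R p q -> probability Omega R).
Variables (tau : {mfun Omega >-> R}) (X1 : {mfun Omega >-> p.-tuple R})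
  (S1 : {mfun Omega >-> R}) (X2 : {mfun Omega >-> q.-tuple R})
  (S2 : {mfun Omega >-> R}).
Hypothesis model : scale_mixture_model m1 m2 Pi P tau X1 S1 X2 S2.
Hypothesis Pi_pos : Pi `]0%R, +oo[%classic = 1.
Variable par : parameter R p q.
Hypothesis adm : admissible par.

Local Notation mu := (@lebesgue_measure R).
Local Notation c1 := (sigma1 par ^+ 2)%R.
Local Notation c2 := (sigma2 par ^+ 2)%R.

(** Independence of tau and (V1, V2) in integrated form. The factorization is asked for t > 0 only,
    as the weight vanishes elsewhere. *)
Lemma sample_variances_separable (F : R * R -> R) (k : R -> R) (g : R * R -> R) :
  measurable_fun [set: R * R] F -> (forall z, 0 <= F z)%R ->
  measurable_fun [set: R] k -> (forall t, 0 < t -> 0 <= k t)%R ->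
  measurable_fun [set: R * R] g -> (forall z, 0 <= g z)%R ->
  (forall t x y, 0 < t -> F (c1 / t * x, c2 / t * y) = k t * g (x, y))%R ->
  \int[P par]_w (F (S1 w, S2 w))%:E =
  \int[Pi]_(t in `]0%R, +oo[) (k t)%:E *
  \int[mu]_x \int[mu]_y (g (x, y) * (chi2_pdf m1 x * chi2_pdf m2 y))%:E.
Proof.
move=> mF F0 mk k0 mg g0 Fkg.
rewrite (sample_variances_law model adm (F := EFin \o F)); last 2 first.
- exact/measurable_EFinP.
- by move=> z; rewrite lee_fin.
pose G (z : R * R) := (g z * (chi2_pdf m1 z.1 * chi2_pdf m2 z.2))%:E.
have mG : measurable_fun [set: R * R] G.
  apply/measurable_EFinP; apply: measurable_funM => //; apply: measurable_funM.
    exact: (measurableT_comp (@measurable_chi2_pdf R m1)).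
  exact: (measurableT_comp (@measurable_chi2_pdf R m2)).
have G0 z : 0 <= G z by rewrite lee_fin !mulr_ge0 ?chi2_pdf_ge0.
rewrite -ge0_integralZr//; last 3 first.
- exact/measurable_EFinP/measurable_funTS.
- by move=> t; rewrite /= in_itv/= andbT => t0; rewrite lee_fin k0.
- by apply: integral_ge0 => x _; apply: integral_ge0 => y _; exact: (G0 (x, y)).
rewrite [RHS]integral_mkcond; apply: eq_integral => t _.
rewrite patchE indicE mem_setE in_itv/= andbT; case: ltP => t0; last first.
  rewrite integral0_eq// => x _; rewrite integral0_eq// => y _.
  by rewrite mul0r mule0.
rewrite -ge0_integralZl//; last 3 first.
- exact: (measurable_fun_fubini_tonelli_F (m2 := mu) G mG G0).
- by move=> x _; apply: integral_ge0 => y _; exact: (G0 (x, y)).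
- by rewrite lee_fin k0.
apply: eq_integral => x _.
rewrite -ge0_integralZl//; last 3 first.
- by apply: (measurableT_comp mG).
- by move=> y _; exact: (G0 (x, y)).
- by rewrite lee_fin k0.
by apply: eq_integral => y _; rewrite Fkg// mul1r -!EFinM -mulrA.
Qed.

Let integral_Pi1 : \int[Pi]_(t in `]0%R, +oo[) (1%R)%:E = 1.
Proof. by rewrite integral_cst// mul1e. Qed.

(** Multiplication by sigma_i^2 / tau preserves signs, and the chi-square densities vanish off the
    positive axis. *)
Lemma sample_variances_gt0 :
  P par [set w | ~~ ((0 < S1 w) && (0 < S2 w))%R] = 0.
Proof.
have [s10 s20 _] := adm.
pose A : set (R * R) := [set z | ~~ ((0 < z.1) && (0 < z.2))%R].
have mA : measurable A.
  apply: measurable_set_bool; apply: measurable_neg.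
  by apply: measurable_and; exact: measurable_fun_ltr.
have mS : measurable_fun [set: Omega] (fun w => (S1 w, S2 w)) by exact/measurable_fun_pair.
transitivity (\int[P par]_w (\1_A (S1 w, S2 w))%:E).
  rewrite -[in LHS](setIT [set w | _]) -[LHS]integral_indic//.
  by rewrite -[X in measurable X]setTI; exact: (mS measurableT A).
rewrite (@sample_variances_separable \1_A (fun=> 1%R) \1_A)//.
  rewrite integral_Pi1 mul1e integral0_eq// => x _; rewrite integral0_eq// => y _.
  rewrite indicE; case: (boolP (_ \in _)); rewrite ?mul0r// inE /A/= negb_and -!leNgt.
  by case/orP => /chi2_pdf_le0 ->; rewrite ?mul0r !mulr0.
move=> t x y t0; rewrite mul1r !indicE; congr ((_ : bool)%:R).
have c1t : (0 < c1 / t)%R by rewrite divr_gt0 ?exprn_gt0.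
have c2t : (0 < c2 / t)%R by rewrite divr_gt0 ?exprn_gt0.
by apply/idP/idP; rewrite !inE /A/= (pmulr_rgt0 _ c1t) (pmulr_rgt0 _ c2t).
Qed.

(* The absolute values only make the integrands nonnegative off the almost sure
   event [0 < S1, 0 < S2]. *)
Lemma sample_variances_ratio_moment (h : R -> R) :
  (0 < m1)%N -> (0 < m2)%N ->
  measurable_fun [set: R] h -> (forall x, 0 <= h x)%R ->
  \int[P par]_w (h (S2 w / S1 w) * (`|S1 w| / c1))%:E =
  mean_inv Pi * (m1 + m2)%:R%:E *
  \int[P par]_w (h (S2 w / S1 w) / (1 + `|S2 w / S1 w| / (c2 / c1)))%:E.
Proof.
move=> m10 m20 mh h0.
have [s10 s20 _] := adm.
have c10 : (0 < c1)%R by rewrite exprn_gt0.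
have c20 : (0 < c2)%R by rewrite exprn_gt0.
pose r : R := (c2 / c1)%R; have r0 : (0 < r)%R by rewrite divr_gt0.
have mdiv : measurable_fun [set: R * R] (fun z : R * R => z.2 / z.1)%R.
  apply: measurable_funM => //; exact: (measurableT_comp (@measurable_invr R)).
(* The mixing variable cancels: S2 / S1 = r V2 / V1. *)
have ratioE t x y : (0 < t)%R ->
    (c2 / t * y / (c1 / t * x) = r * (y / x))%R.
  move=> t0; rewrite /r (invfM (c1 / t)%R) invf_div.
  rewrite (_ : c2 / t * y * (t / c1 * x^-1) = (t^-1 * t) * (c2 / c1 * (y / x)))%R; last by ring.
  by rewrite mulVf ?gt_eqF// mul1r.
pose hr (u : R) := h (r * u)%R.
have mhr : measurable_fun [set: R] hr by apply: (measurableT_comp mh).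
have mden : measurable_fun [set: R] (fun u : R => (1 + `|u| / r)^-1)%R.
  apply: (measurableT_comp (@measurable_invr R)); apply: measurable_funD => //.
  by apply: measurable_funM => //; exact: measurableT_comp.
have den0 (u : R) : (0 <= (1 + `|u| / r)^-1)%R.
  by rewrite invr_ge0 addr_ge0// divr_ge0// ltW.
(* Here the tau-part is 1 / t, because S1 / sigma1^2 = V1 / tau. *)
rewrite (@sample_variances_separable
    (fun z => h (z.2 / z.1) * (`|z.1| / c1))%R (fun t => t^-1)%R
    (fun z => hr (z.2 / z.1) * `|z.1|)%R); last 7 first.
- apply: measurable_funM; first exact: (measurableT_comp mh).
  by apply: measurable_funM => //; exact: measurableT_comp.
- by move=> z; rewrite mulr_ge0// divr_ge0// ltW.
- exact: measurable_invr.
- by move=> t t0; rewrite invr_ge0 ltW.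
- apply: measurable_funM; first exact: (measurableT_comp mhr).
  exact: measurableT_comp.
- by move=> z; rewrite mulr_ge0//; exact: h0.
- move=> t x y t0 /=; rewrite ratioE// /hr normrM gtr0_norm ?divr_gt0//.
  rewrite (_ : c1 / t * `|x| / c1 = (c1 / c1) * (t^-1 * `|x|))%R; last by ring.
  by rewrite divff ?gt_eqF//; ring.
rewrite integral_inv_mean_inv//.
(* The right integrand depends on the ratio only, so its tau-part is 1. *)
rewrite [X in _ = _ * X](@sample_variances_separable
    (fun z => h (z.2 / z.1) / (1 + `|z.2 / z.1| / r))%R (fun=> 1%R)
    (fun z => hr (z.2 / z.1) / (1 + `|z.2 / z.1|))%R); last 7 first.
- apply: measurable_funM; first exact: (measurableT_comp mh).
  exact: (measurableT_comp mden).
- by move=> z; rewrite mulr_ge0.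
- exact: measurable_cst.
- by [].
- apply: measurable_funM; first exact: (measurableT_comp mhr).
  apply: (measurableT_comp (@measurable_invr R)); apply: measurable_funD => //.
  exact: measurableT_comp.
- by move=> z; rewrite divr_ge0 ?addr_ge0//; exact: h0.
- move=> t x y t0 /=; rewrite mul1r ratioE// /hr normrM (gtr0_norm r0).
  by rewrite (mulrC r `|y / x|%R) mulfK ?gt_eqF.
rewrite integral_Pi1 mul1e -muleA; congr (_ * _).
transitivity (\int[mu]_x \int[mu]_y
    (hr (y / x) * (`|x| * chi2_pdf m1 x * chi2_pdf m2 y))%:E).
  by apply: eq_integral => x _; apply: eq_integral => y _; rewrite !mulrA.
by rewrite integral_chi2_ratio// => x; exact: h0.
Qed.

End sample_variances_moments.

(** * Positivity of [mean_inv], and an abstract comparison of two expected losses *)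

(** If the integral were 0, the positive function 1 / t would vanish almost everywhere on []0,
    +oo[], a set of mass 1. This makes the denominator of [phi11E] positive. *)
Lemma mean_inv_gt0 (R : realType) (Pi : probability R R) :
  Pi `]0, +oo[%classic = 1%E -> (0 < mean_inv Pi)%E.
Proof.
move=> Pi_pos; rewrite -integral_inv_mean_inv// lt0e; apply/andP; split; last first.
  apply: integral_ge0 => t; rewrite /= in_itv/= andbT => t0.
  by rewrite lee_fin invr_ge0 ltW.
apply/eqP => I0.
have mV : measurable_fun (`]0, +oo[%classic : set R) (fun t : R => (t^-1)%:E).
  by apply/measurable_EFinP/measurable_funTS; exact: measurable_invr.
have /(ae_eq_integral_abs Pi (measurable_itv _) mV)[N [mN N0 subN]] :
    (\int[Pi]_(t in `]0%R, +oo[) `|(t^-1)%:E| = 0)%E.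
  rewrite -[RHS]I0; apply: eq_integral => t.
  rewrite inE/= in_itv/= andbT => t0.
  by rewrite ger0_norm// invr_ge0 ltW.
have : (Pi `]0%R, +oo[%classic <= Pi N)%E.
  apply: le_measure; rewrite ?inE// => t t0; apply: subN => /(_ t0)/eqP.
  move: t0; rewrite /= in_itv/= andbT => t0.
  by rewrite eqe invr_eq0 gt_eqF.
by rewrite N0 Pi_pos leNgt lte_fin ltr01.
Qed.

(* [a] and [b] are the losses of the old and the new estimator; writing
   [a - b = e - k] as [a + k = b + e] keeps every term nonnegative, and
   [e <= 2 a + 2] makes all the integrals finite. *)
Section risk_comparison.
Local Open Scope ereal_scope.
Context d (T : measurableType d) (R : realType) (P : probability T R).
Variables (a b k e j : T -> R).
Hypotheses (ma : measurable_fun [set: T] a) (mb : measurable_fun [set: T] b)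
  (mk : measurable_fun [set: T] k) (me : measurable_fun [set: T] e)
  (mj : measurable_fun [set: T] j).
Hypotheses (a0 : forall w, (0 <= a w)%R) (b0 : forall w, (0 <= b w)%R)
  (k0 : forall w, (0 <= k w)%R) (e0 : forall w, (0 <= e w)%R).
Hypotheses (akbe : forall w, (a w + k w = b w + e w)%R)
  (kj : forall w, (k w <= j w)%R) (e_le : forall w, (e w <= 2 * a w + 2)%R).
Hypotheses (aoo : \int[P]_w (a w)%:E < +oo)
  (je : \int[P]_w (j w)%:E <= \int[P]_w (e w)%:E).

Let j0 w : (0 <= j w)%R. Proof. exact: le_trans (kj w). Qed.

Let fin_e : \int[P]_w (e w)%:E < +oo.
Proof.
apply: (@le_lt_trans _ _ (\int[P]_w (2%:E * (a w)%:E + 2%:E))).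
  apply: ge0_le_integral => //.
  - by move=> w _; rewrite lee_fin.
  - exact/measurable_EFinP.
  - by apply/measurable_EFinP; apply: measurable_funD => //; exact: measurable_funM.
  - by move=> w _; rewrite lee_fin.
rewrite ge0_integralD//; last 2 first.
- by move=> w _; rewrite lee_fin mulr_ge0.
- by apply/measurable_EFinP; exact: measurable_funM.
rewrite ge0_integralZl//; last 2 first.
- exact/measurable_EFinP.
- by move=> w _; rewrite lee_fin.
rewrite lte_add_pinfty//; first by rewrite lte_mul_pinfty.
by rewrite integral_cst//= probability_setT mule1 ltry.
Qed.

Let int_kj : \int[P]_w (k w)%:E <= \int[P]_w (j w)%:E.
Proof.
apply: ge0_le_integral => //.
- by move=> w _; rewrite lee_fin.
- exact/measurable_EFinP.
- exact/measurable_EFinP.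
- by move=> w _; rewrite lee_fin.
Qed.

Let int_akbe : \int[P]_w (a w)%:E + \int[P]_w (k w)%:E =
  \int[P]_w (b w)%:E + \int[P]_w (e w)%:E.
Proof.
rewrite -!ge0_integralD//; try (by move=> w _; rewrite lee_fin);
  try exact/measurable_EFinP.
by apply: eq_integral => w _; rewrite -!EFinD akbe.
Qed.

(** With capitals for the integrals, A + K = B + E and K <= J <= E give B <= A. Equality K = J would
    force j = k almost everywhere, which is excluded when k < j has positive probability. *)
Lemma risk_comparison_le : \int[P]_w (b w)%:E <= \int[P]_w (a w)%:E /\
  (0 < P [set w | (k w < j w)%R] -> \int[P]_w (b w)%:E < \int[P]_w (a w)%:E).
Proof.
have ge0 (f : T -> R) : (forall w, 0 <= f w)%R -> 0 <= \int[P]_w (f w)%:E.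
  by move=> f0; apply: integral_ge0 => w _; rewrite lee_fin.
have fine_ (f : T -> R) : (forall w, 0 <= f w)%R -> \int[P]_w (f w)%:E < +oo ->
    exists r : R, \int[P]_w (f w)%:E = r%:E.
  move=> f0 foo; exists (fine (\int[P]_w (f w)%:E)).
  by rewrite fineK// ge0_fin_numE// ge0.
have [A EA] := fine_ _ a0 aoo.
have [E EE] := fine_ _ e0 fin_e.
have [J EJ] := fine_ _ j0 (le_lt_trans je fin_e).
have [K EK] := fine_ _ k0 (le_lt_trans int_kj (le_lt_trans je fin_e)).
have boo : \int[P]_w (b w)%:E < +oo.
  apply: (@le_lt_trans _ _ (\int[P]_w (b w)%:E + \int[P]_w (e w)%:E)).
    by rewrite leeDl// ge0.
  by rewrite -int_akbe EA EK -EFinD ltry.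
have [B EB] := fine_ _ b0 boo.
move: int_akbe int_kj je; rewrite EA EB EE EJ EK -!EFinD => -[AKBE].
rewrite !lee_fin => KJ JE; split; first by lra.
move=> Pkj; rewrite lte_fin; suff : (K < J)%R by lra.
rewrite lt_neqAle KJ andbT; apply/eqP => KJE.
have mjk : measurable_fun [set: T] (fun w => (j w - k w)%R) by exact: measurable_funB.
have JK : \int[P]_w (j w)%:E = \int[P]_w (j w - k w)%:E + \int[P]_w (k w)%:E.
  rewrite -ge0_integralD//.
  - by apply: eq_integral => w _; rewrite -EFinD subrK.
  - by move=> w _; rewrite lee_fin subr_ge0.
  - exact/measurable_EFinP.
  - by move=> w _; rewrite lee_fin.
  - exact/measurable_EFinP.
have I0 : \int[P]_w `|(j w - k w)%:E| = 0.
  rewrite (eq_integral (fun w => (j w - k w)%:E)); last first.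
    by move=> w _; rewrite /= ger0_norm// subr_ge0.
  move: JK; rewrite EJ EK KJE => /eqP; rewrite eq_sym -[X in _ == X]add0e.
  by move=> /eqP/(congr1 (fun z => z - J%:E)); rewrite !addeK.
have /(ae_eq_integral_abs P measurableT)[|N [mN N0 subN]] := I0.
  exact/measurable_EFinP.
have : P [set w | (k w < j w)%R] <= P N.
  apply: le_measure; rewrite ?inE//.
    by apply: measurable_set_bool; exact: measurable_fun_ltr.
  move=> w /= kjw; apply: subN => /= /(_ Logic.I)/eqP.
  by rewrite eqe subr_eq0 gt_eqF.
by rewrite N0 leNgt Pkj.
Qed.

End risk_comparison.

(** * Bounds on the logarithm and the entropy loss *)

Section logarithm_bounds.
Context (R : realType).
Implicit Types x : R.

Lemma ln_le_subr1 x : 0 < x -> ln x <= x - 1.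
Proof.
by move=> x0; have := @le_ln1Dx R (x - 1); rewrite subrKC; apply; lra.
Qed.

Lemma ln_lt_subr1 x : 1 < x -> ln x < x - 1.
Proof.
move=> x1; have x0 : 0 < x by lra.
rewrite -ltr_expR lnK ?posrE//.
have : x - 1 != 0 by rewrite subr_eq0 gt_eqF.
by move/expR_gt1Dx; rewrite subrKC.
Qed.

(** The bound ln y <= y - 1 at y = x / 2 and at y = 2: the constants -1 and 1 cancel. *)
Lemma ln_le_half x : 0 < x -> ln x <= x / 2.
Proof.
move=> x0; have -> : ln x = ln (x / 2) + ln 2.
  by rewrite ln_div ?posrE//; ring.
have := @ln_le_subr1 (x / 2); have := @ln_le_subr1 2; lra.
Qed.

End logarithm_bounds.

Lemma entropy_loss_ge0 (R : realType) (delta s2 : R) :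
  0 < delta -> 0 < s2 -> 0 <= entropy_loss delta s2.
Proof.
move=> d0 s0; rewrite /entropy_loss.
by have := @ln_le_subr1 R (delta / s2) (divr_gt0 d0 s0); lra.
Qed.

(** By [ln_le_half] the loss is at least half of [delta / s2], minus 1. Finite risk thus bounds the
    mean of [delta / s2]. *)
Lemma le_entropy_loss (R : realType) (delta s2 : R) :
  0 < delta -> 0 < s2 -> delta / s2 <= 2 * entropy_loss delta s2 + 2.
Proof.
move=> d0 s0; rewrite /entropy_loss.
by have := @ln_le_half R (delta / s2) (divr_gt0 d0 s0); lra.
Qed.

(** The terms ln (s / c) cancel. This is the identity a + k = b + e of the risk comparison where
    truncation acts. *)
Lemma entropy_lossMB (R : realType) (f g s c : R) :
  0 < f -> 0 < g -> 0 < s -> 0 < c ->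
  entropy_loss (f * s) c + ln (f / g) =
  entropy_loss (g * s) c + (f - g) * (s / c).
Proof.
move=> f0 g0 s0 c0; rewrite /entropy_loss -!mulrA.
have sc0 : 0 < s / c by rewrite divr_gt0.
by rewrite ln_div ?posrE// !(@lnM _ _ (s / c)) ?posrE//; ring.
Qed.

(** * Risk improvement at a fixed parameter *)

Section risk_improvement.
Context (R : realType) (p q m1 m2 : nat) (Pi : probability R R).
Context (d : measure_display) (Omega : measurableType d).
Variables (P : parameter R p q -> probability Omega R).
Variables (tau : {mfun Omega >-> R}) (X1 : {mfun Omega >-> p.-tuple R})
  (S1 : {mfun Omega >-> R}) (X2 : {mfun Omega >-> q.-tuple R})
  (S2 : {mfun Omega >-> R}).
Hypotheses (m1_gt0 : (0 < m1)%N) (m2_gt0 : (0 < m2)%N).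
Hypothesis Pi_pos : Pi `]0, +oo[%classic = 1%E.
Hypothesis mean_inv_fin : mean_inv Pi \is a fin_num.
Hypothesis model : scale_mixture_model m1 m2 Pi P tau X1 S1 X2 S2.
Variable phi1 : R -> R.
Hypothesis phi1_meas : measurable_fun [set: R] phi1.
Hypothesis phi1_pos : forall z : R, 0 < z -> 0 < phi1 z.

Local Notation phi2 := (phi11E m1 m2 Pi).
Local Notation Z w := (S2 w / S1 w).

Variable par : parameter R p q.
Hypothesis adm : admissible par.
Local Notation c1 := (sigma1 par ^+ 2).

Let M := fine (mean_inv Pi).
Let n : R := (m1 + m2)%:R.

Let n0 : 0 < n. Proof. by rewrite ltr0n addn_gt0 m1_gt0. Qed.

Let M0 : 0 < M.
Proof. by rewrite fine_gt0// mean_inv_gt0//= ltey_eq mean_inv_fin. Qed.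

Let c10 : 0 < c1.
Proof. by have [s10 _ _] := adm; rewrite exprn_gt0. Qed.

Let phi2_gt0 z : 0 < z -> 0 < phi2 z.
Proof. by move=> z0; rewrite divr_gt0 ?mulr_gt0 ?addr_gt0. Qed.

Let mphi2 : measurable_fun [set: R] phi2.
Proof. by apply: measurable_funM => //; exact: measurable_funD. Qed.

Let mZ : measurable_fun [set: Omega] (fun w => Z w).
Proof.
by apply: measurable_funM => //; exact: (measurableT_comp (@measurable_invr R)).
Qed.

Let mphi1Z : measurable_fun [set: Omega] (fun w => phi1 (Z w)).
Proof. exact: (measurableT_comp phi1_meas). Qed.

Let mphi2Z : measurable_fun [set: Omega] (fun w => phi2 (Z w)).
Proof. exact: (measurableT_comp mphi2). Qed.

(** An almost sure event on which the ratio is positive, hence so are [phi1] and [phi2] there. *)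
Let D w := (0 < S1 w) && (0 < S2 w).
Let B w := D w && (phi2 (Z w) < phi1 (Z w)).

Let mD : measurable_fun [set: Omega] D.
Proof. by apply: measurable_and; exact: measurable_fun_ltr. Qed.

Let mB : measurable_fun [set: Omega] B.
Proof. by apply: measurable_and => //; exact: measurable_fun_ltr. Qed.

Let N : set Omega := [set w | ~~ D w].

Let mN : measurable N.
Proof. by apply: measurable_set_bool; exact: measurable_neg. Qed.

Let PN0 : P par N = 0%E.
Proof. exact: (sample_variances_gt0 model Pi_pos adm). Qed.

Let Z0 w : D w -> 0 < Z w.
Proof. by case/andP => ? ?; rewrite divr_gt0. Qed.

Let m_entropy (f : Omega -> R) : measurable_fun [set: Omega] f ->
  measurable_fun [set: Omega] (fun w => entropy_loss (f w * S1 w) c1).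
Proof.
move=> mf; have mfS : measurable_fun [set: Omega] (fun w => f w * S1 w / c1).
  by apply: measurable_funM => //; exact: measurable_funM.
apply: measurable_funB => //; apply: measurable_funB => //.
exact: (measurableT_comp (@measurable_ln R)).
Qed.

(** Setting the loss to 0 on the null set [N] makes the integrands for both estimators nonnegative
    everywhere, as the risk comparison requires. *)
Let risk_eq (f : Omega -> R) : measurable_fun [set: Omega] f ->
  risk P (fun w => f w * S1 w) par =
  (\int[P par]_w (if D w then entropy_loss (f w * S1 w) c1 else 0)%:E)%E.
Proof.
move=> mf; rewrite /risk unlock.
apply: (@integral_eq_off_null _ _ R (P par) N) => //.
- by apply/measurable_EFinP; exact: m_entropy.
- by apply/measurable_EFinP; apply: measurable_fun_ifT => //; exact: m_entropy.
- by move=> w /negP; rewrite negbK => ->.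
Qed.

(** These play the letters of the risk comparison: on [B] truncation lowers the loss by [e - k], and
    [j] bounds [k] through ln x <= x - 1. *)
Let k w := if B w then ln (phi1 (Z w) / phi2 (Z w)) else 0.
Let e w := if B w then (phi1 (Z w) - phi2 (Z w)) * (S1 w / c1) else 0.
Let j w := if B w then phi1 (Z w) / phi2 (Z w) - 1 else 0.

Let mphi12 : measurable_fun [set: Omega] (fun w => phi1 (Z w) / phi2 (Z w)).
Proof.
by apply: measurable_funM => //; exact: (measurableT_comp (@measurable_invr R)).
Qed.

Let mk : measurable_fun [set: Omega] k.
Proof.
by apply: measurable_fun_ifT => //; exact: (measurableT_comp (@measurable_ln R)).
Qed.

Let me : measurable_fun [set: Omega] e.
Proof.
apply: measurable_fun_ifT => //; apply: measurable_funM.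
  exact: measurable_funB.
exact: measurable_funM.
Qed.

Let mj : measurable_fun [set: Omega] j.
Proof. by apply: measurable_fun_ifT => //; exact: measurable_funB. Qed.

Let ratio_gt1 w : B w -> 1 < phi1 (Z w) / phi2 (Z w).
Proof.
by case/andP => /Z0 z0 lt21; rewrite ltr_pdivlMr ?mul1r// phi2_gt0.
Qed.

(** The excess phi1 - phi2 as a nonnegative function of the ratio alone, the form that the moment
    identity takes. *)
Let h z := if (0 < z) && (phi2 z < phi1 z) then phi1 z - phi2 z else 0.

Let mh : measurable_fun [set: R] h.
Proof.
apply: measurable_fun_ifT => //; last exact: measurable_funB.
by apply: measurable_and; exact: measurable_fun_ltr.
Qed.

Let h0 z : 0 <= h z.
Proof. by rewrite /h; case: ifP => // /andP[_ /ltW]; rewrite subr_ge0. Qed.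

Let int_j_le_e : (\int[P par]_w (j w)%:E <= \int[P par]_w (e w)%:E)%E.
Proof.
have [s10 s20 s12] := adm.
have c20 : 0 < sigma2 par ^+ 2 by rewrite exprn_gt0.
pose r := sigma2 par ^+ 2 / c1.
(* The order restriction enters here. *)
have r1 : 1 <= r by rewrite ler_pdivlMr// mul1r ler_pXn2r// nnegrE ltW.
have r0 : 0 < r by lra.
have mH : measurable_fun [set: Omega] (fun w => h (Z w) / (1 + `|Z w| / r)).
  apply: measurable_funM; first exact: (measurableT_comp mh).
  apply: (measurableT_comp (@measurable_invr R)); apply: measurable_funD => //.
  by apply: measurable_funM => //; exact: (measurableT_comp (@normr_measurable R setT)).
have H0 w : 0 <= h (Z w) / (1 + `|Z w| / r).
  by rewrite divr_ge0// addr_ge0// divr_ge0// ltW.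
rewrite (@integral_eq_off_null _ _ R (P par) N (fun w => (e w)%:E)
    (fun w => (h (Z w) * (`|S1 w| / c1))%:E)) => //; last 3 first.
- exact/measurable_EFinP.
- apply/measurable_EFinP; apply: measurable_funM.
    exact: (measurableT_comp mh).
  by apply: measurable_funM => //; exact: measurableT_comp.
- move=> w /negP; rewrite negbK => Dw; rewrite /e /h /B Dw Z0//=.
  by case: ifP; rewrite ?mul0r// ger0_norm//; case/andP: Dw => /ltW.
rewrite (sample_variances_ratio_moment model)// -/r -(fineK mean_inv_fin).
rewrite -/M -/n -EFinM -ge0_integralZl//; last 3 first.
- exact/measurable_EFinP.
- by move=> w _; rewrite lee_fin.
- by rewrite lee_fin mulr_ge0// ltW.
(* After the moment identity a pointwise inequality remains. On [B], division by phi1 - phi2 turns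
   it into 1 / phi2(Z) = M n / (1 + Z) <= M n / (1 + Z / r). *)
apply: ge0_le_integral => //.
- move=> w _; rewrite lee_fin /j; case: ifP => // /ratio_gt1; lra.
- exact/measurable_EFinP.
- by apply/measurable_EFinP; exact: measurable_funM.
move=> w _; rewrite lee_fin /j; case: ifP => [Bw|_]; last first.
  by rewrite mulr_ge0// mulr_ge0// ltW.
have /andP[Dw lt21] := Bw; have z0 := Z0 Dw.
rewrite /h z0 lt21/= gtr0_norm//.
have p20 := phi2_gt0 z0.
have -> : phi1 (Z w) / phi2 (Z w) - 1 = (phi1 (Z w) - phi2 (Z w)) / phi2 (Z w).
  by rewrite mulrBl divff ?gt_eqF.
rewrite mulrCA ler_pM2l ?subr_gt0//.
rewrite /phi11E invf_div -/M -/n [M * n]mulrC ler_pM2l ?mulr_gt0//.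
have zr : Z w / r <= Z w by rewrite ler_pdivrMr// ler_peMr// ltW.
have zr0 : 0 < Z w / r by rewrite divr_gt0.
by rewrite lef_pV2 ?posrE//; lra.
Qed.

Lemma risk_improvement :
  let delta w := phi1 (Z w) * S1 w in
  let delta' w := Num.min (phi1 (Z w)) (phi2 (Z w)) * S1 w in
  (risk P delta par < +oo)%E ->
  (risk P delta' par <= risk P delta par)%E /\
  ((0 < P par [set w | (phi2 (Z w) < phi1 (Z w))%R])%E ->
   (risk P delta' par < risk P delta par)%E).
Proof.
move=> delta delta'.
have mmin : measurable_fun [set: Omega] (fun w => Num.min (phi1 (Z w)) (phi2 (Z w))).
  exact: measurable_minr.
rewrite /delta /delta' !risk_eq// => aoo.
have [|||||||||le_ba lt_ba] := @risk_comparison_le _ _ R (P par)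
  (fun w => if D w then entropy_loss (phi1 (Z w) * S1 w) c1 else 0)
  (fun w => if D w then
     entropy_loss (Num.min (phi1 (Z w)) (phi2 (Z w)) * S1 w) c1 else 0)
  k e j _ _ mk me mj _ _ _ _ _ _ _ aoo int_j_le_e.
- by apply: measurable_fun_ifT => //; exact: m_entropy.
- by apply: measurable_fun_ifT => //; exact: m_entropy.
- move=> w; case: ifP => // Dw; have /andP[S10 _] := Dw.
  by rewrite entropy_loss_ge0// mulr_gt0// phi1_pos// Z0.
- move=> w; case: ifP => // Dw; have /andP[S10 _] := Dw.
  by rewrite entropy_loss_ge0// mulr_gt0// lt_min phi1_pos ?phi2_gt0 ?Z0.
- by move=> w; rewrite /k; case: ifP => // /ratio_gt1 /ltW /ln_ge0.
- move=> w; rewrite /e; case: ifP => // /andP[/andP[S10 _] /ltW lt21].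
  by rewrite mulr_ge0 ?subr_ge0// divr_ge0// ltW.
(* On [D] outside [B] the minimum is phi1 and the two losses agree. *)
- move=> w; rewrite /k /e /B; case: ifP => //= Dw; have /andP[S10 _] := Dw.
  case: ltP => [lt21|_]; last by rewrite !addr0.
  by rewrite entropy_lossMB// ?phi1_pos ?phi2_gt0 ?Z0.
- move=> w; rewrite /k /j; case: ifP => // /ratio_gt1 /ln_lt_subr1/ltW//.
(* On [B], e is at most phi1 S1 / sigma1^2, which [le_entropy_loss] controls. *)
- move=> w; rewrite /e /B; case: ifP => [/andP[Dw lt21]|_]; last first.
    case: ifP => [Dw|_]; last by lra.
    have /andP[S10 _] := Dw.
    have := @entropy_loss_ge0 R (phi1 (Z w) * S1 w) c1.
    by rewrite mulr_gt0 ?phi1_pos ?Z0// => /(_ isT c10); lra.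
  have /andP[S10 _] := Dw; rewrite Dw.
  apply: le_trans (le_entropy_loss _ _) => //; last first.
    by rewrite mulr_gt0 ?phi1_pos ?Z0.
  rewrite -mulrA ler_pM2r ?divr_gt0// lerBlDr lerDl ltW// phi2_gt0// Z0//.
split => // PB; apply: lt_ba.
have mlt : measurable [set w | (phi2 (Z w) < phi1 (Z w))%R].
  by apply: measurable_set_bool; exact: measurable_fun_ltr.
have mkj : measurable [set w | (k w < j w)%R].
  by apply: measurable_set_bool; exact: measurable_fun_ltr.
apply: (lt_le_trans PB).
(* Up to the null set [N], truncation acts only where the logarithm bound is strict. *)
apply: (@le_trans _ _ (P par ([set w | (k w < j w)%R] `|` N))).
  apply: le_measure; rewrite ?inE//; first exact: measurableU.
  move=> w /= lt21; case: (boolP (D w)) => Dw; [left|right => //].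
  have Bw : B w by rewrite /B Dw.
  by rewrite /= /k /j Bw; exact/ln_lt_subr1/ratio_gt1.
by rewrite -[leRHS]adde0 -PN0; exact: measureU2.
Qed.

End risk_improvement.

Theorem theorem2p2 (R : realType) (p q m1 m2 : nat)
  (p_gt0 : (0 < p)%N) (q_gt0 : (0 < q)%N)
  (m1_gt0 : (0 < m1)%N) (m2_gt0 : (0 < m2)%N)
  (Pi : probability R R)
  (Pi_pos : Pi `]0, +oo[%classic = 1%E)
  (mean_inv_fin : mean_inv Pi \is a fin_num)
  (d : measure_display) (Omega : measurableType d)
  (P : parameter R p q -> probability Omega R)
  (tau : {mfun Omega >-> R})
  (X1 : {mfun Omega >-> p.-tuple R}) (S1 : {mfun Omega >-> R})
  (X2 : {mfun Omega >-> q.-tuple R}) (S2 : {mfun Omega >-> R})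
  (model : scale_mixture_model m1 m2 Pi P tau X1 S1 X2 S2)
  (phi1 : R -> R)
  (phi1_meas : measurable_fun [set: R] phi1)
  (phi1_pos : forall z : R, 0 < z -> 0 < phi1 z) :
  let Z1 := fun w => S2 w / S1 w in
  let delta_phi1 := fun w => phi1 (Z1 w) * S1 w in
  let delta_S1E :=
    fun w => Num.min (phi1 (Z1 w)) (phi11E m1 m2 Pi (Z1 w)) * S1 w in
  (forall par, admissible par -> (risk P delta_phi1 par < +oo)%E) ->
  (exists2 par, admissible par &
    (0 < P par [set w | (phi11E m1 m2 Pi (Z1 w) < phi1 (Z1 w))%R])%E) ->
  dominates P delta_S1E delta_phi1.
Proof.
move=> Z1 delta_phi1 delta_S1E fin_risk [par0 adm0 P0].
have improve par (adm : admissible par) := risk_improvement m1_gt0 m2_gt0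
  Pi_pos mean_inv_fin model phi1_meas phi1_pos adm (fin_risk par adm).
split => [par adm|]; first by have [] := improve par adm.
by exists par0; split => //; have [_] := improve par0 adm0; apply.
Qed.
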